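(* Let $(M,\tilde\varphi,\xi,\eta,\tilde g)$ be a paracontact metric $(\tilde\kappa,\tilde\mu)$-manifold with $\tilde\kappa<-1$, and set $\tilde\lambda=\sqrt{-1-\tilde\kappa}$; assume the index of $\mathcal D_{\tilde\varphi\tilde h}(\pm\tilde\lambda)$ is constant on $M$. Then for any $X,X',X''\in\Gamma(\mathcal D_{\tilde\varphi\tilde h}(\tilde\lambda))$ and $Y,Y',Y''\in\Gamma(\mathcal D_{\tilde\varphi\tilde h}(-\tilde\lambda))$: $$\tilde R_{XX'}X''=(\tilde\kappa-1+\tilde\mu)\bigl(\tilde g(X',X'')X-\tilde g(X,X'')X'\bigr)+\tilde\lambda\bigl(\tilde g(X',X'')\tilde\varphi X-\tilde g(X,X'')\tilde\varphi X'\bigr),$$ $$\tilde R_{XX'}Y=-\tilde\lambda\bigl(\tilde g(X',\tilde\varphi Y)X-\tilde g(X,\tilde\varphi Y)X'\bigr)-(1-\tilde\mu)\bigl(\tilde g(X',\tilde\varphi Y)\tilde\varphi X-\tilde g(X,\tilde\varphi Y)\tilde\varphi X'\bigr),$$ $$\tilde R_{XY}X'=-\tilde\lambda\tilde g(X',\tilde\varphi Y)X-\tilde g(X',\tilde\varphi Y)\tilde\varphi X-\tilde\lambda^2\tilde g(X,X')Y+\tilde\lambda\tilde g(X,X')\tilde\varphi Y-\tilde\mu\tilde g(X,\tilde\varphi Y)\tilde\varphi X',$$ $$\tilde R_{XY}Y'=\tilde\lambda^2\tilde g(Y,Y')X+\tilde\lambda\tilde g(Y,Y')\tilde\varphi X+\tilde\lambda\tilde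 g(X,\tilde\varphi Y')Y-\tilde g(X,\tilde\varphi Y')\tilde\varphi Y-\tilde\mu\tilde g(X,\tilde\varphi Y)\tilde\varphi Y',$$ $$\tilde R_{YY'}X=-\tilde\lambda\bigl(\tilde g(X,\tilde\varphi Y')Y-\tilde g(X,\tilde\varphi Y)Y'\bigr)+(1-\tilde\mu)\bigl(\tilde g(X,\tilde\varphi Y')\tilde\varphi Y-\tilde g(X,\tilde\varphi Y)\tilde\varphi Y'\bigr),$$ $$\tilde R_{YY'}Y''=(\tilde\kappa-1+\tilde\mu)\bigl(\tilde g(Y',Y'')Y-\tilde g(Y,Y'')Y'\bigr)-\tilde\lambda\bigl(\tilde g(Y',Y'')\tilde\varphi Y-\tilde g(Y,Y'')\tilde\varphi Y'\bigr).$$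
   Context: Conventions: $2d\eta(X,Y)=X(\eta(Y))-Y(\eta(X))-\eta([X,Y])$; $\tilde R_{XY}Z=\tilde\nabla_X\tilde\nabla_YZ-\tilde\nabla_Y\tilde\nabla_XZ-\tilde\nabla_{[X,Y]}Z$ with $\tilde\nabla$ the Levi-Civita connection of $\tilde g$. An almost paracontact structure on a $(2n+1)$-dimensional manifold $M$ is $(\tilde\varphi,\xi,\eta)$, with $\tilde\varphi$ a $(1,1)$-tensor field, $\xi$ a vector field, $\eta$ a 1-form, such that $\eta(\xi)=1$, $\tilde\varphi^2=I-\eta\otimes\xi$ and the $\pm1$-eigendistributions of $\tilde\varphi$ on $\mathcal D=\ker\eta$ both have dimension $n$. With a pseudo-Riemannian metric $\tilde g$ satisfying $\tilde g(\tilde\varphi X,\tilde\varphi Y)=-\tilde g(X,Y)+\eta(X)\eta(Y)$ and $d\eta(X,Y)=\tilde g(X,\tilde\varphi Y)$ it is a paracontact metric structure. Put $\tilde h=\frac12\mathcal L_\xi\tilde\varphi$. A paracontact metric $(\tilde\kappa,\tilde\mu)$-manifold ($\tilde\kappa,\tilde\mu$ real constants) is a paracontact metric manifold whose curvature tensor satisfies $\tilde R_{XY}\xi=\tilde\kappa(\eta(Y)X-\eta(X)Y)+\tilde\mu(\eta(Y)\tilde hX-\eta(X)\tilde hY)$ for all vector fields $X,Y$. When $\tilde\kappa<-1$, $\tilde\varphi\tilde h$ is diagonalizable with eigenvalues $0$ (eigenspace $\mathbb R\xi$) and $\pm\tilde\lambda$ (each of multiplicity $n$); $\mathcal D_{\tilde\varphi\tilde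 h}(\pm\tilde\lambda)$ denote the $\pm\tilde\lambda$-eigendistributions, and the index is that of the restriction of $\tilde g$. *)

(* Defs.v *)
From HB Require Import structures.
From mathcomp Require Import all_boot all_order all_algebra.
From mathcomp Require Import all_classical all_reals all_analysis.
From mathcomp Require Import ring.

Set Implicit Arguments.
Unset Strict Implicit.
Unset Printing Implicit Defensive.

Import Order.TTheory GRing.Theory Num.Theory.
Import numFieldNormedType.Exports.

Local Open Scope classical_set_scope.
Local Open Scope ring_scope.

Section SmoothMaps.
Context {R : realType} {V W : normedModType R}.

(* C^k on an open set U: f and all its iterated directional derivatives of order
   at most k exist and are continuous on U. *)
Fixpoint is_Ck (k : nat) (U : set V) (f : V -> W) : Prop :=
  (forall x, U x -> {for x, continuous f}) /\
  (if k is k'.+1 then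
     forall v, (forall x, U x -> derivable f x v) /\ is_Ck k' U ('D_v f)
   else True).

Definition smooth_on (U : set V) (f : V -> W) : Prop :=
  forall k, is_Ck k U f.

Lemma is_Ck_eq k (U : set V) (f h : V -> W) : open U ->
  (forall x, U x -> f x = h x) -> is_Ck k U f -> is_Ck k U h.
Proof.
move=> oU; elim: k f h => [|k IH] f h fh /= [cf df].
- split=> // x Ux.
  have nfh : \forall y \near x, f y = h y.
    by near=> y; apply: fh; near: y; exact: open_nbhs_nbhs.
  rewrite /prop_for /continuous_at -fh//.
  by apply: cvg_trans (cf x Ux); apply: near_eq_cvg.
- have nfh x : U x -> \forall y \near x, f y = h y.
    by move=> Ux; near=> y; apply: fh; near: y; exact: open_nbhs_nbhs.
  split=> [x Ux|v].
    rewrite /prop_for /continuous_at -fh//.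
    by apply: cvg_trans (cf x Ux); apply: near_eq_cvg; exact: nfh.
  have [d1 d2] := df v; split=> [x Ux|].
    by apply: (@near_eq_derivable _ _ _ f) (d1 x Ux); exact: nfh.
  by apply: IH d2 => x Ux; apply: near_eq_derive; exact: nfh.
Unshelve. all: by end_near. Qed.

Lemma is_Ck_cst k (U : set V) (c : W) : is_Ck k U (cst c).
Proof.
elim: k c => [|k IH] c /=; split=> //; try by move=> x _; exact: cst_continuous.
move=> v; split=> [x _|]; first exact: derivable_cst.
rewrite (_ : 'D_v (cst c) = cst 0); first exact: IH.
by apply/funext => x; rewrite derive_cst.
Qed.

Lemma is_CkB k (U : set V) (f h : V -> W) : open U ->
  is_Ck k U f -> is_Ck k U h -> is_Ck k U (f - h).
Proof.
move=> oU; elim: k f h => [|k IH] f h /= [cf df] [ch dh].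
  by split=> // x Ux; apply: continuousB; [exact: cf | exact: ch].
split=> [x Ux|v]; first by apply: continuousB; [exact: cf | exact: ch].
have [d1 d2] := df v; have [e1 e2] := dh v; split=> [x Ux|].
  by apply: derivableB; [exact: d1 | exact: e1].
apply: is_Ck_eq oU _ (IH _ _ d2 e2) => x Ux.
by rewrite deriveB//; [exact: d1 | exact: e1].
Qed.

End SmoothMaps.

Lemma is_Ck_pred {R : realType} {V W : normedModType R} k (U : set V)
  (f : V -> W) : is_Ck k.+1 U f -> is_Ck k U f.
Proof.
elim: k f => [|k IH] f [cf df]; first by split.
by split=> // v; have [d1 d2] := df v; split=> //; exact: IH.
Qed.

Lemma is_CkD {R : realType} {V W : normedModType R} k (U : set V)
  (f h : V -> W) : open U ->
  is_Ck k U f -> is_Ck k U h -> is_Ck k U (f + h).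
Proof.
move=> oU Hf Hh.
have -> : f + h = f - (cst 0 - h).
  by apply/funext => x /=; rewrite !fctE sub0r opprK.
by do 2!apply: is_CkB => //; exact: is_Ck_cst.
Qed.

Lemma is_CkM {R : realType} {V : normedModType R} k (U : set V)
  (f h : V -> R) : open U ->
  is_Ck k U f -> is_Ck k U h -> is_Ck k U (f * h).
Proof.
move=> oU; elim: k f h => [|k IH] f h.
  move=> [cf _] [ch _]; split=> // x Ux.
  by apply: continuousM; [exact: cf | exact: ch].
move=> Hf Hh; have Hf' := is_Ck_pred Hf; have Hh' := is_Ck_pred Hh.
move: Hf Hh => /= [cf df] [ch dh]; split=> [x Ux|v].
  by apply: continuousM; [exact: cf | exact: ch].
have [d1 d2] := df v; have [e1 e2] := dh v; split=> [x Ux|].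
  by apply: derivableM; [exact: d1 | exact: e1].
apply: (@is_Ck_eq _ _ _ _ _ (f * 'D_v h + h * 'D_v f)) => //.
  by move=> x Ux; rewrite deriveM//; [exact: d1 | exact: e1].
by apply: is_CkD => //; exact: IH.
Qed.

Section Manifold.
Variables (R : realType) (m : nat).

(* A chart is a homeomorphism from an open set cdom onto an open subset of R^m;
   cmap and cinv are total, and only their values on cdom and on its image
   matter. *)
Record chart (T : topologicalType) := Chart {
  cdom : set T;
  cmap : T -> 'rV[R]_m;
  cinv : 'rV[R]_m -> T;
  cdom_open : open cdom;
  cimg_open : open (cmap @` cdom);
  cmapK : forall x, cdom x -> cinv (cmap x) = x;
  cmap_cont : forall x, cdom x -> {for x, continuous cmap};
  cinv_cont : forall y, (cmap @` cdom) y -> {for y, continuous cinv} }.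

Record manifold := Manifold {
  mcarrier :> topologicalType;
  atlas : set (chart mcarrier);
  atlas_cover : forall x, exists2 c, atlas c & cdom c x;
  atlas_compat : forall c d, atlas c -> atlas d ->
    smooth_on (cmap c @` (cdom c `&` cdom d)) (cmap d \o cinv c);
  mhausdorff : hausdorff_space mcarrier;
  msecond_countable : @second_countable mcarrier }.

End Manifold.

Section SmoothFunctions.
Context {R : realType} {m : nat} (M : manifold R m).

Definition smooth_fun : {pred M -> R} := fun f =>
  `[< forall c, atlas c -> smooth_on (cmap c @` cdom c) (f \o cinv c : _ -> R) >].

Lemma smooth_fun_subring : subring_closed smooth_fun.
Proof.
split.
- by apply/asboolP => c _ k; exact: is_Ck_cst.
- move=> f h /asboolP Hf /asboolP Hh; apply/asboolP => c Ac k.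
  rewrite (_ : _ \o _ = (f \o cinv c) - (h \o cinv c)); last exact/funext.
  by apply: is_CkB; [exact: cimg_open | exact: Hf | exact: Hh].
- move=> f h /asboolP Hf /asboolP Hh; apply/asboolP => c Ac k.
  rewrite (_ : _ \o _ = (f \o cinv c) * (h \o cinv c)); last exact/funext.
  by apply: is_CkM; [exact: cimg_open | exact: Hf | exact: Hh].
Qed.

HB.instance Definition _ :=
  GRing.isSubringClosed.Build (M -> R) smooth_fun smooth_fun_subring.

(* The ring C^oo(M); it is the zero ring when M is empty. *)
Record cinf := CInf { cinf_val :> M -> R; _ : cinf_val \in smooth_fun }.

HB.instance Definition _ := [isSub for cinf_val].
HB.instance Definition _ := [Choice of cinf by <:].
HB.instance Definition _ :=
  GRing.SubChoice_isSubComPzRing.Build (M -> R) smooth_fun cinf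
    smooth_fun_subring.

Lemma smooth_fun_cst (a : R) : (cst a : M -> R) \in smooth_fun.
Proof. by apply/asboolP => c _ k; exact: is_Ck_cst. Qed.

Definition cinf_cst (a : R) : cinf := CInf (smooth_fun_cst a).

End SmoothFunctions.

Notation "a %:C" := (cinf_cst _ a)
  (at level 1, left associativity, format "a %:C") : ring_scope.

Section VectorFields.
Context {R : realType} {m : nat} (M : manifold R m).
Implicit Types (f h : cinf M) (p : M).

(* Tangent vectors at p are the R-linear point derivations of C^oo(M) at p. *)
Definition point_derivation p : {pred cinf M -> R^o} := fun v =>
  `[< [/\ forall f h, v (f + h) = v f + v h,
          forall (a : R) f, v (a%:C * f) = a * v f
        & forall f h, v (f * h) = v f * h p + f p * v h] >].

Lemma point_derivation_submod p : subsemimod_closed (point_derivation p).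
Proof.
split; first split.
- have z f : (0 : cinf M -> R^o) f = 0 by [].
  by apply/asboolP; split=> *; rewrite !z ?mulr0 ?mul0r ?addr0.
- move=> u v /asboolP[u1 u2 u3] /asboolP[v1 v2 v3]; apply/asboolP; split.
  + by move=> f h; rewrite !fctE u1 v1 addrACA.
  + by move=> a f; rewrite !fctE u2 v2 mulrDr.
  + by move=> f h; rewrite !fctE u3 v3 mulrDl mulrDr addrACA.
- move=> b v /asboolP[v1 v2 v3]; apply/asboolP; split.
  + by move=> f h; rewrite !fctE v1 scalerDr.
  + by move=> a f; rewrite !fctE v2 /GRing.scale/= mulrCA.
  + by move=> f h; rewrite !fctE v3 /GRing.scale/= mulrDr mulrA (mulrCA b).
Qed.

HB.instance Definition _ p :=
  GRing.isSubSemiModClosed.Build R (cinf M -> R^o) (point_derivation p)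
    (point_derivation_submod p).

Record tangent p := Tangent {
  tangent_val :> cinf M -> R^o;
  _ : tangent_val \in point_derivation p }.

HB.instance Definition _ p := [isSub for @tangent_val p].
HB.instance Definition _ p := [Choice of tangent p by <:].
HB.instance Definition _ p := [SubChoice_isSubLmodule of tangent p by <:].

(* Vector fields are the R-linear derivations of C^oo(M): the field X is
   determined by the smooth functions X f : p |-> X_p f. *)
Definition derivation : {pred cinf M -> (cinf M)^o} := fun D =>
  `[< [/\ forall f h, D (f + h) = D f + D h,
          forall (a : R) f, D (a%:C * f) = a%:C * D f
        & forall f h, D (f * h) = D f * h + f * D h] >].

Lemma derivation_submod : subsemimod_closed derivation.
Proof.
split; first split.
- have z f : (0 : cinf M -> (cinf M)^o) f = 0 by [].
  by apply/asboolP; split=> *; rewrite !z ?mulr0 ?mul0r ?addr0.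
- move=> u v /asboolP[u1 u2 u3] /asboolP[v1 v2 v3]; apply/asboolP; split.
  + by move=> f h; rewrite !fctE u1 v1 addrACA.
  + by move=> a f; rewrite !fctE u2 v2 mulrDr.
  + by move=> f h; rewrite !fctE u3 v3 mulrDl mulrDr addrACA.
- move=> b v /asboolP[v1 v2 v3]; apply/asboolP; split.
  + by move=> f h; rewrite !fctE v1 scalerDr.
  + by move=> a f; rewrite !fctE v2 /GRing.scale/= mulrCA.
  + by move=> f h; rewrite !fctE v3 /GRing.scale/= mulrDr mulrA (mulrCA b).
Qed.

HB.instance Definition _ :=
  GRing.isSubSemiModClosed.Build (cinf M) (cinf M -> (cinf M)^o) derivation
    derivation_submod.

Record vfield := VField {
  vfield_val :> cinf M -> (cinf M)^o;
  _ : vfield_val \in derivation }.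

HB.instance Definition _ := [isSub for vfield_val].
HB.instance Definition _ := [Choice of vfield by <:].
HB.instance Definition _ := [SubChoice_isSubLmodule of vfield by <:].

Lemma lie_subproof (X Y : vfield) :
  (fun f => X (Y f) - Y (X f) : (cinf M)^o) \in derivation.
Proof.
case: X Y => [X /= /asboolP[X1 X2 X3]] [Y /= /asboolP[Y1 Y2 Y3]].
apply/asboolP; split.
- by move=> f h; rewrite X1 Y1 X1 Y1 opprD addrACA.
- by move=> a f; rewrite Y2 X2 X2 Y2 -mulrBr.
- by move=> f h; rewrite Y3 X3 X1 Y1 !X3 !Y3; ring.
Qed.

Definition lie (X Y : vfield) : vfield := VField (lie_subproof X Y).

Lemma value_subproof p (X : vfield) :
  (fun f => X f p : R^o) \in point_derivation p.
Proof.
case: X => [X /= /asboolP[X1 X2 X3]]; apply/asboolP; split.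
- by move=> f h; rewrite X1.
- by move=> a f; rewrite X2.
- by move=> f h; rewrite X3.
Qed.

Definition value p (X : vfield) : tangent p := Tangent (value_subproof p X).

End VectorFields.

Section Geometry.
Context {R : realType} {m : nat} {M : manifold R m}.
Implicit Types (X Y Z : vfield M) (p : M).

(* Tensor fields are C^oo(M)-multilinear maps on vector fields.  Since value p X
   is X_p and every tangent vector extends to a global vector field,
   metric_nondeg says that g_p is nondegenerate on T_pM for every p. *)
Record pseudo_riemannian (g : vfield M -> vfield M -> cinf M) : Prop := {
  metric_sym : forall X Y, g X Y = g Y X;
  metric_add : forall X Y Z, g (X + Y) Z = g X Z + g Y Z;
  metric_scale : forall (f : cinf M) X Z, g (f *: X) Z = f * g X Z;
  metric_nondeg : forall p X, (forall Y, g X Y p = 0) -> value p X = 0 }.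

Record levi_civita (g : vfield M -> vfield M -> cinf M)
    (nabla : vfield M -> vfield M -> vfield M) : Prop := {
  nabla_addl : forall X Y Z, nabla (X + Y) Z = nabla X Z + nabla Y Z;
  nabla_scalel : forall (f : cinf M) X Z, nabla (f *: X) Z = f *: nabla X Z;
  nabla_addr : forall X Y Z, nabla X (Y + Z) = nabla X Y + nabla X Z;
  nabla_leibniz : forall (f : cinf M) X Y,
    nabla X (f *: Y) = X f *: Y + f *: nabla X Y;
  nabla_torsion : forall X Y, nabla X Y - nabla Y X = lie X Y;
  nabla_metric : forall X Y Z,
    X (g Y Z) = g (nabla X Y) Z + g Y (nabla X Z) }.

Definition curvature (nabla : vfield M -> vfield M -> vfield M) X Y Z :
    vfield M :=
  nabla X (nabla Y Z) - nabla Y (nabla X Z) - nabla (lie X Y) Z.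

(* Exterior derivative, normalized by
   2 d eta (X, Y) = X (eta Y) - Y (eta X) - eta [X, Y]. *)
Definition d1 (eta : vfield M -> cinf M) X Y : cinf M :=
  (2^-1)%:C * (X (eta Y) - Y (eta X) - eta (lie X Y)).

Definition lie_derive_endo (xi : vfield M) (A : vfield M -> vfield M) X : vfield M :=
  lie xi (A X) - A (lie xi X).

Definition has_dim p (S : set (tangent p)) (k : nat) : Prop :=
  exists e : 'I_k -> tangent p,
    (forall a : 'I_k -> R, \sum_i a i *: e i = 0 -> forall i, a i = 0) /\
    S = [set v | exists a : 'I_k -> R, v = \sum_i a i *: e i].

(* Fibers at p of the c-eigendistribution of an endomorphism field A and of
   ker eta.  They are expressed through vector fields extending a tangent
   vector: such extensions exist, and for C^oo(M)-linear A and eta the value at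
   p does not depend on the one chosen. *)
Definition eigen_at (A : vfield M -> vfield M) (c : R) p : set (tangent p) :=
  [set v | exists2 X, v = value p X & value p (A X) = c *: v].

Definition ker_at (eta : vfield M -> cinf M) p : set (tangent p) :=
  [set v | exists2 X, v = value p X & eta X p = 0].

Definition eigen_section (A : vfield M -> vfield M) (c : R) X : Prop :=
  A X = c%:C *: X.

Definition negative_frame (g : vfield M -> vfield M -> cinf M) p
    (S : set (tangent p)) (k : nat) : Prop :=
  exists E : 'I_k -> vfield M,
    (forall i, S (value p (E i))) /\
    (forall a : 'I_k -> R, (exists i, a i != 0) ->
       let X := \sum_i (a i)%:C *: E i in g X X p < 0).

(* The index of the restriction of g_p to the subspace S of T_pM: the largest
   dimension of a subspace of S on which g_p is negative definite. *)
Definition index_at (g : vfield M -> vfield M -> cinf M) p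
    (S : set (tangent p)) (k : nat) : Prop :=
  negative_frame g S k /\ forall j, negative_frame g S j -> (j <= k)%N.

End Geometry.

Arguments eigen_at {R m M} A c p _.
Arguments ker_at {R m M} eta p _.

Section Paracontact.
Context {R : realType} {n : nat} {M : manifold R n.*2.+1}.

Record almost_paracontact (phi : {linear vfield M -> vfield M})
    (xi : vfield M) (eta : {scalar vfield M}) : Prop := {
  apc_eta_xi : eta xi = 1;
  apc_phi2 : forall X, phi (phi X) = X - eta X *: xi;
  apc_dim_plus : forall p : M, has_dim (eigen_at phi 1 p `&` ker_at eta p) n;
  apc_dim_minus :
    forall p : M, has_dim (eigen_at phi (-1) p `&` ker_at eta p) n }.

Record paracontact_metric (phi : {linear vfield M -> vfield M})
    (xi : vfield M) (eta : {scalar vfield M})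
    (g : vfield M -> vfield M -> cinf M) : Prop := {
  pcm_apc : almost_paracontact phi xi eta;
  pcm_metric : pseudo_riemannian g;
  pcm_compat : forall X Y, g (phi X) (phi Y) = - g X Y + eta X * eta Y;
  pcm_deta : forall X Y, d1 eta X Y = g X (phi Y) }.

Definition h_tensor (phi : vfield M -> vfield M) (xi X : vfield M) : vfield M :=
  (2^-1)%:C *: lie_derive_endo xi phi X.

Definition kappa_mu_condition (phi : vfield M -> vfield M) (xi : vfield M)
    (eta : vfield M -> cinf M) (nabla : vfield M -> vfield M -> vfield M)
    (kappa mu : R) : Prop :=
  let h := h_tensor phi xi in
  forall X Y, curvature nabla X Y xi =
    kappa%:C *: (eta Y *: X - eta X *: Y) +
    mu%:C *: (eta Y *: h X - eta X *: h Y).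

End Paracontact.

(* Main.v *)
From HB Require Import structures.
Require Import Defs.
From mathcomp Require Import all_boot all_order all_algebra.
From mathcomp Require Import all_classical all_reals all_analysis.
From mathcomp Require Import ring.

Set Implicit Arguments.
Unset Strict Implicit.
Unset Printing Implicit Defensive.

Import Order.TTheory GRing.Theory Num.Theory.
Import numFieldNormedType.Exports.

Local Open Scope classical_set_scope.
Local Open Scope ring_scope.

(**
The proof is tensor calculus over the ring of smooth functions: an identity
between vector fields is tested against every W with the nondegenerate metric,
and what remains is an identity in a commutative ring.

Let A be the symmetric part of nabla xi.  The contact condition says that the
skew part is - phi, so nabla_X xi = A X - phi X; the first Bianchi identity
makes the 2-form g(X, phi Y) closed, which gives nabla_xi phi = 0,
A phi = - phi A and h = phi A (lemmas [nabla_phi_cyclic], [shape_phi],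
[h_tensorE]).  Hence phi h = A, and the eigendistributions of the theorem are
those of A.  The curvature condition on R(X, xi) xi splits into the part
commuting with phi and the part anticommuting with it:
A^2 = - (1 + kappa) phi^2 and nabla_xi A = - mu phi A ([shape_shape],
[nabla_xi_shape]).

The heart of the matter is that phi and A are parallel along D = ker eta up to
terms containing xi ([nabla_phi_horizontal], [nabla_shape_horizontal]).  The
curvature condition on horizontal R(X, Y) xi is a Codazzi equation linking the
trilinear forms F = g((nabla_X phi) Y, Z) and B = g((nabla_X A) Y, Z).
Differentiating A^2 = l^2 phi^2 with l nonzero kills B when its last two
arguments lie in the same eigendistribution; the Codazzi equation and the
symmetries of F and B under permutations and under phi then kill F, and
after that B.

Consequently the commutators [R(X, Y), phi] and [R(X, Y), A] are explicit on
horizontal fields ([ricci_phi], [ricci_shape]).  The commutator with A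
determines g(R(X, Y) Z, W) when Z and W belong to opposite eigendistributions;
the Bianchi identity, the pair symmetry and the commutator with phi yield the
other components.  Everything is done for an eigenvalue l of either sign with
l^2 = - 1 - kappa, and the last three formulas are the first three ones with
- lambda in place of lambda and the two families of fields exchanged.
*)

(** * Smooth functions and vector fields *)

Section VectorFieldAlgebra.
Context {R : realType} {m : nat} {M : manifold R m}.
Implicit Types (X Y Z W : vfield M) (f h : cinf M).

Fact cinf_cst_zmod_morphism : zmod_morphism (@cinf_cst R m M).
Proof. by move=> a b; apply/val_inj/funext. Qed.

Fact cinf_cst_monoid_morphism : monoid_morphism (@cinf_cst R m M).
Proof. by split=> [|a b]; apply/val_inj/funext. Qed.

HB.instance Definition _ := GRing.isZmodMorphism.Build R (cinf M)
  (@cinf_cst R m M) cinf_cst_zmod_morphism.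
HB.instance Definition _ := GRing.isMonoidMorphism.Build R (cinf M)
  (@cinf_cst R m M) cinf_cst_monoid_morphism.

(** Smooth functions have zero divisors, so the arguments below cancel constants
only. *)
Lemma cinf_cst_mulI (a : R) f h : a != 0 -> a%:C * f = a%:C * h -> f = h.
Proof.
move=> a0 E; rewrite -[f]mul1r -[h]mul1r.
by rewrite -(rmorph1 (@cinf_cst R m M)) -(mulVf a0) rmorphM -!mulrA E.
Qed.

Lemma cinf_double_inj f h : f + f = h + h -> f = h.
Proof.
move=> E; apply: (@cinf_cst_mulI 2); first by rewrite pnatr_eq0.
by rewrite rmorph_nat !mulr_natl !mulr2n.
Qed.

Lemma vfield_derivation X :
  [/\ forall f h, X (f + h) = X f + X h,
      forall (a : R) f, X (a%:C * f) = a%:C * X f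
    & forall f h, X (f * h) = X f * h + f * X h].
Proof. by case: X => X /= /asboolP. Qed.

Lemma vfieldD X f h : X (f + h) = X f + X h.
Proof. by have [] := vfield_derivation X. Qed.

Lemma vfieldM X f h : X (f * h) = X f * h + f * X h.
Proof. by have [] := vfield_derivation X. Qed.

Lemma vfield0 X : X 0 = 0.
Proof. by apply: (addrI (X 0)); rewrite -vfieldD !addr0. Qed.

Lemma vfieldN X f : X (- f) = - X f.
Proof. by apply: (addrI (X f)); rewrite -vfieldD !subrr vfield0. Qed.

Lemma vfieldB X f h : X (f - h) = X f - X h.
Proof. by rewrite vfieldD vfieldN. Qed.

Lemma vfield1 X : X 1 = 0.
Proof.
apply: (addrI (X 1)); rewrite addr0 -[in RHS](mulr1 1) vfieldM.
by rewrite mulr1 mul1r.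
Qed.

Lemma vfield_cst X (a : R) : X a%:C = 0.
Proof.
by have [_ XZ _] := vfield_derivation X; rewrite -[_%:C]mulr1 XZ vfield1 mulr0.
Qed.

Lemma vfield_eq X Y : (forall p, value p X = value p Y) -> X = Y.
Proof.
move=> XY; apply/val_inj/funext => f; apply/val_inj/funext => p.
exact: (congr1 (fun v : tangent p => v f) (XY p)).
Qed.

Lemma lieE X Y f : lie X Y f = X (Y f) - Y (X f) :> cinf M.
Proof. by []. Qed.

Lemma lieC X Y : lie X Y = - lie Y X.
Proof. by apply/val_inj/funext => f /=; rewrite fctE /= opprB. Qed.

Lemma lie_jacobi X Y Z :
  lie X (lie Y Z) + lie Y (lie Z X) + lie Z (lie X Y) = 0.
Proof.
apply/val_inj/funext => f; transitivity (0 : cinf M); last by [].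
by rewrite /= !fctE /= !vfieldB; ring.
Qed.

End VectorFieldAlgebra.

(** * Metrics and Levi-Civita connections *)

Section Metric.
Context {R : realType} {m : nat} {M : manifold R m}.
Variables (g : vfield M -> vfield M -> cinf M) (Hg : pseudo_riemannian g).
Implicit Types (X Y Z W : vfield M) (f h : cinf M).

Let gC := Defs.metric_sym Hg.

Lemma metricDl X Y Z : g (X + Y) Z = g X Z + g Y Z.
Proof. exact: metric_add Hg X Y Z. Qed.

Lemma metricDr X Y Z : g Z (X + Y) = g Z X + g Z Y.
Proof. by rewrite !(gC Z) metricDl. Qed.

Lemma metricZl f X Z : g (f *: X) Z = f * g X Z.
Proof. exact: metric_scale Hg f X Z. Qed.

Lemma metricZr f X Z : g Z (f *: X) = f * g Z X.
Proof. by rewrite !(gC Z) metricZl. Qed.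

Lemma metricNl X Z : g (- X) Z = - g X Z.
Proof. by rewrite -scaleN1r metricZl mulN1r. Qed.

Lemma metricNr X Z : g Z (- X) = - g Z X.
Proof. by rewrite !(gC Z) metricNl. Qed.

Lemma metric0l Z : g 0 Z = 0.
Proof. by rewrite -(scale0r 0) metricZl mul0r. Qed.

Lemma metric0r Z : g Z 0 = 0.
Proof. by rewrite gC metric0l. Qed.

Definition metricE := (metricDl, metricDr, metricZl, metricZr, metricNl,
  metricNr, metric0l, metric0r).

Lemma metric_inj X Y : (forall W, g X W = g Y W) -> X = Y.
Proof.
move=> E; apply/eqP; rewrite -subr_eq0; apply/eqP/vfield_eq => p.
rewrite (metric_nondeg Hg (p := p)); first by apply/val_inj/funext.
by move=> W; rewrite metricDl metricNl E subrr.
Qed.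

End Metric.
Arguments metric_inj {R m M g} Hg X Y _.

(** The covariant derivative (nabla_X A) Y of an endomorphism field. It is
locked so that rewriting with the bilinearity of the metric does not unfold it.
*)
HB.lock Definition nabla_endo {R : realType} {m : nat} {M : manifold R m}
  (nabla : vfield M -> vfield M -> vfield M) (A : vfield M -> vfield M)
  (X Y : vfield M) : vfield M := nabla X (A Y) - A (nabla X Y).

Section Connection.
Context {R : realType} {m : nat} {M : manifold R m}.
Variables (g : vfield M -> vfield M -> cinf M) (Hg : pseudo_riemannian g).
Variable nabla : vfield M -> vfield M -> vfield M.
Hypothesis Hlc : levi_civita g nabla.
Implicit Types (X Y Z W : vfield M) (f h : cinf M).

Let gE := metricE Hg.
Let gC := Defs.metric_sym Hg.

Lemma nablaDr X Y Z : nabla X (Y + Z) = nabla X Y + nabla X Z.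
Proof. exact: nabla_addr Hlc X Y Z. Qed.

Lemma nabla0r X : nabla X 0 = 0.
Proof. by apply: (addrI (nabla X 0)); rewrite -nablaDr !addr0. Qed.

Lemma nablaNr X Y : nabla X (- Y) = - nabla X Y.
Proof. by apply: (addrI (nabla X Y)); rewrite -nablaDr !subrr nabla0r. Qed.

Lemma nablaBr X Y Z : nabla X (Y - Z) = nabla X Y - nabla X Z.
Proof. by rewrite nablaDr nablaNr. Qed.

Lemma nablaDl X Y Z : nabla (X + Y) Z = nabla X Z + nabla Y Z.
Proof. exact: nabla_addl Hlc X Y Z. Qed.

Lemma nablaZl f X Z : nabla (f *: X) Z = f *: nabla X Z.
Proof. exact: nabla_scalel Hlc f X Z. Qed.

Lemma nablaNl X Z : nabla (- X) Z = - nabla X Z.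
Proof. by rewrite -scaleN1r nablaZl scaleN1r. Qed.

Lemma torsion_free X Y : lie X Y = nabla X Y - nabla Y X.
Proof. by rewrite (nabla_torsion Hlc). Qed.

Lemma metric_compatible X Y Z : g (nabla X Y) Z = X (g Y Z) - g Y (nabla X Z).
Proof. by rewrite (nabla_metric Hlc) addrK. Qed.

Local Notation nabla_endo := (nabla_endo nabla).

Lemma nabla_endoE A X Y : nabla_endo A X Y = nabla X (A Y) - A (nabla X Y).
Proof. by rewrite unlock. Qed.

Definition rm X Y Z W := g (curvature nabla X Y Z) W.

Lemma curvature_skew X Y Z : curvature nabla X Y Z = - curvature nabla Y X Z.
Proof.
apply: (metric_inj Hg) => W; rewrite /curvature (lieC X Y) nablaNl !gE.
by ring.
Qed.

Lemma rm_skewl X Y Z W : rm X Y Z W = - rm Y X Z W.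
Proof. by rewrite /rm curvature_skew gE. Qed.

(** The scalar function g(Z, W) is annihilated by X Y - Y X - [X, Y]; expanding
this with the compatibility of nabla and g gives the skew-symmetry. *)
Lemma rm_skewr X Y Z W : rm X Y Z W = - rm X Y W Z.
Proof.
have := lieE X Y (g Z W).
rewrite !(nabla_metric Hlc) !vfieldD !(nabla_metric Hlc) => /eqP.
rewrite -subr_eq0 => /eqP E; apply/eqP; rewrite -subr_eq0 -oppr_eq0 -E.
rewrite /rm /curvature !gE !(gC Z); apply/eqP; ring.
Qed.

(** Without torsion, the cyclic sum of the curvature reduces to the cyclic sum
of [X, [Y, Z]]. *)
Lemma first_bianchi X Y Z : curvature nabla X Y Z + curvature nabla Y Z X
  + curvature nabla Z X Y = 0.
Proof.
apply: (metric_inj Hg) => W; have := congr1 (g ^~ W) (lie_jacobi X Y Z).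
rewrite /curvature !gE !(torsion_free X) !(torsion_free Y) !(torsion_free Z).
by rewrite !nablaBr !gE => <-; ring.
Qed.

Lemma rm_bianchi X Y Z W : rm X Y Z W + rm Y Z X W + rm Z X Y W = 0.
Proof. by rewrite /rm -!(metricDl Hg) first_bianchi (metric0l Hg). Qed.

Lemma rm_pair X Y Z W : rm X Y Z W = rm Z W X Y.
Proof.
apply: cinf_double_inj; apply/eqP; rewrite -subr_eq0; apply/eqP.
(* the octahedron argument: a signed sum of the four Bianchi identities *)
transitivity ((rm X Y Z W + rm Y Z X W + rm Z X Y W)
  + (rm Y Z W X + rm Z W Y X + rm W Y Z X)
  - (rm Z W X Y + rm W X Z Y + rm X Z W Y)
  - (rm W X Y Z + rm X Y W Z + rm Y W X Z)); last first.
  by rewrite !rm_bianchi; ring.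
rewrite (rm_skewl Z X) (rm_skewr Y Z W X) (rm_skewr Z W Y X).
rewrite (rm_skewl W Y) (rm_skewr Y W Z X) (rm_skewl W X Z) (rm_skewr X W Z Y).
rewrite (rm_skewr X Z W Y) (rm_skewl W X Y) (rm_skewr X Y W Z).
by ring.
Qed.

Lemma curvatureE X Y Z : curvature nabla X Y Z =
  nabla X (nabla Y Z) - nabla Y (nabla X Z) - nabla (lie X Y) Z.
Proof. by []. Qed.

Lemma nabla_endo_sym (A : vfield M -> vfield M) :
    (forall X Y, g (A X) Y = g X (A Y)) ->
  forall X Y Z, g (nabla_endo A X Y) Z = g (nabla_endo A X Z) Y.
Proof.
move=> symA X Y Z; rewrite !nabla_endoE !gE.
have := nabla_metric Hlc X (A Y) Z; have := nabla_metric Hlc X Y (A Z).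
rewrite !symA (gC Y (nabla X (A Z))) => -> /eqP.
rewrite -subr_eq0 => /eqP E; rewrite -[LHS]addr0 -E (gC _ (A Y)) symA.
by ring.
Qed.

Lemma nabla_endo_skew (A : vfield M -> vfield M) :
    (forall X Y, g (A X) Y = - g X (A Y)) ->
  forall X Y Z, g (nabla_endo A X Y) Z = - g (nabla_endo A X Z) Y.
Proof.
move=> skA X Y Z; rewrite !nabla_endoE !gE.
have := nabla_metric Hlc X (A Y) Z; have := nabla_metric Hlc X Y (A Z).
rewrite !skA (gC (nabla X (A Z))) vfieldN => -> /eqP.
rewrite -subr_eq0 => /eqP E.
by rewrite -[LHS]addr0 -E (gC _ (A Y)) skA; ring.
Qed.

Section LinearEndo.
Variable A : {linear vfield M -> vfield M}.

Lemma nabla_endoDl X Y Z :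
  nabla_endo A (X + Y) Z = nabla_endo A X Z + nabla_endo A Y Z.
Proof. by rewrite !nabla_endoE !nablaDl linearD opprD addrACA. Qed.

Lemma nabla_endoZl f X Z : nabla_endo A (f *: X) Z = f *: nabla_endo A X Z.
Proof. by rewrite !nabla_endoE !nablaZl linearZ scalerBr. Qed.

Lemma nabla_endoDr X Y Z :
  nabla_endo A Z (X + Y) = nabla_endo A Z X + nabla_endo A Z Y.
Proof. by rewrite !nabla_endoE !(linearD, nablaDr) addrACA. Qed.

Lemma nabla_endoZr f X Z : nabla_endo A Z (f *: X) = f *: nabla_endo A Z X.
Proof.
rewrite !nabla_endoE linearZ !(nabla_leibniz Hlc) linearD !linearZ scalerBr.
by rewrite opprD addrACA subrr add0r.
Qed.

Lemma ricci_identity X Y Z :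
  curvature nabla X Y (A Z) - A (curvature nabla X Y Z) =
  nabla X (nabla_endo A Y Z) + nabla_endo A X (nabla Y Z)
  - (nabla Y (nabla_endo A X Z) + nabla_endo A Y (nabla X Z))
  - nabla_endo A (lie X Y) Z.
Proof.
apply: (metric_inj Hg) => W; rewrite !curvatureE !nabla_endoE.
by rewrite !(linearB, nablaBr) !gE; ring.
Qed.

Variable xi : vfield M.
Hypothesis xi_unit : g xi xi = 1.
Hypothesis parallel : forall X Y Z, g X xi = 0 -> g Y xi = 0 -> g Z xi = 0 ->
  g (nabla_endo A X Y) Z = 0.

Let perp V : g (V - g V xi *: xi) xi = 0.
Proof. by rewrite !gE xi_unit mulr1 subrr. Qed.

Let decomp V : V = (V - g V xi *: xi) + g V xi *: xi.
Proof. by rewrite subrK. Qed.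

(** If A is parallel along the orthogonal complement of xi modulo xi, second
covariant derivatives of A do not contribute to its Ricci identity on that
complement: each term that survives is a product of a component of nabla xi and
a component of nabla A in which xi occurs. *)
Lemma ricci_parallel_mod X Y Z W :
    g X xi = 0 -> g Y xi = 0 -> g Z xi = 0 -> g W xi = 0 ->
  rm X Y (A Z) W - g (A (curvature nabla X Y Z)) W =
    g (nabla X xi) W * g (nabla_endo A Y Z) xi
    - g (nabla Y xi) W * g (nabla_endo A X Z) xi
    - g (nabla Y xi) Z * g (nabla_endo A X xi) W
    + g (nabla X xi) Z * g (nabla_endo A Y xi) W
    - g (lie X Y) xi * g (nabla_endo A xi Z) W.
Proof.
move=> X0 Y0 Z0 W0.
have perpN U V : g V xi = 0 -> g (nabla U V) xi = - g (nabla U xi) V.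
  by move=> V0; rewrite metric_compatible V0 vfield0 sub0r gC.
have endoN U V U' : g U' xi = 0 -> g V xi = 0 ->
    g (nabla U (nabla_endo A U' V)) W =
    g (nabla U xi) W * g (nabla_endo A U' V) xi.
  move=> U'0 V0; rewrite metric_compatible parallel// vfield0.
  rewrite [in LHS](decomp (nabla U W)) (metricDr Hg) parallel// (metricZr Hg).
  by rewrite perpN//; ring.
have endo_r U V : g U xi = 0 ->
    g (nabla_endo A U V) W = g V xi * g (nabla_endo A U xi) W.
  move=> U0; rewrite [in LHS](decomp V) nabla_endoDr nabla_endoZr.
  by rewrite (metricDl Hg) parallel// add0r (metricZl Hg).
have endo_l V : g (nabla_endo A V Z) W = g V xi * g (nabla_endo A xi Z) W.
  rewrite [in LHS](decomp V) nabla_endoDl nabla_endoZl.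
  by rewrite (metricDl Hg) parallel// add0r (metricZl Hg).
rewrite /rm -(metricNl Hg) -(metricDl Hg) ricci_identity !gE !endoN//.
rewrite (endo_r X) // (endo_r Y) // endo_l !perpN//; ring.
Qed.

End LinearEndo.

End Connection.

(** * Paracontact metric structures *)

(** The symmetric part of nabla xi, equal to phi h by [phi_h_tensorE] below. It
is locked for the same reason as [nabla_endo]. *)
HB.lock Definition shape_operator {R : realType} {m : nat} {M : manifold R m}
  (nabla : vfield M -> vfield M -> vfield M) (phi : vfield M -> vfield M)
  (xi X : vfield M) : vfield M := nabla X xi + phi X.

Section ParacontactMetric.
Context {R : realType} {n : nat} {M : manifold R n.*2.+1}.
Variables (phi : {linear vfield M -> vfield M}) (xi : vfield M).
Variables (eta : {scalar vfield M}) (g : vfield M -> vfield M -> cinf M).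
Variable nabla : vfield M -> vfield M -> vfield M.
Hypothesis Hpcm : paracontact_metric phi xi eta g.
Hypothesis Hlc : levi_civita g nabla.
Implicit Types (X Y Z W : vfield M) (f h : cinf M).

Let Hg := pcm_metric Hpcm.
Let gE := metricE Hg.
Let gC := Defs.metric_sym Hg.
Local Notation nabla_endo := (nabla_endo nabla).
Local Notation rm := (rm g nabla).
Local Notation A := (shape_operator nabla phi xi).

Lemma eta_xi : eta xi = 1.
Proof. exact: apc_eta_xi (pcm_apc Hpcm). Qed.

Lemma phi_phi X : phi (phi X) = X - eta X *: xi.
Proof. exact: apc_phi2 (pcm_apc Hpcm) X. Qed.

(** The contact condition in a form without division. *)
Lemma cartan_eta X Y :
  X (eta Y) - Y (eta X) - eta (lie X Y) = g X (phi Y) + g X (phi Y) :> cinf M.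
Proof.
have half : 2^-1 + 2^-1 = 1 :> R by rewrite [RHS]splitr mul1r.
by rewrite -(pcm_deta Hpcm) /d1 -mulrDl -rmorphD half rmorph1 mul1r.
Qed.

(** Both sides of the contact condition are skew in X and Y. *)
Lemma phi_skew X Y : g (phi X) Y = - g X (phi Y).
Proof.
apply: cinf_double_inj; rewrite gC -cartan_eta (lieC Y) linearN -opprD.
by rewrite -cartan_eta; ring.
Qed.

Lemma metric_xi X : g X xi = eta X.
Proof.
have := pcm_compat Hpcm X xi; rewrite phi_skew phi_phi eta_xi scale1r subrr.
rewrite (metric0r Hg) oppr0 mulr1 => /eqP.
by rewrite eq_sym addrC subr_eq0 => /eqP.
Qed.

Lemma phi_xi : phi xi = 0.
Proof.
have phi0 W : g (phi xi) (phi W) = 0.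
  by rewrite (pcm_compat Hpcm) eta_xi mul1r gC metric_xi addNr.
apply: (metric_inj Hg) => W; rewrite (metric0l Hg).
rewrite -[W](subrK (eta W *: xi)) -phi_phi !gE phi0 add0r.
have -> : g (phi xi) xi = 0; last by rewrite mulr0.
by apply: cinf_double_inj; rewrite [X in X + _]phi_skew gC addNr addr0.
Qed.

Lemma eta_phi X : eta (phi X) = 0.
Proof. by rewrite -metric_xi phi_skew phi_xi gE oppr0. Qed.

Lemma phi_phi_horizontal X : eta X = 0 -> phi (phi X) = X.
Proof. by move=> X0; rewrite phi_phi X0 scale0r subr0. Qed.

Lemma eta_nabla_xi X : eta (nabla X xi) = 0.
Proof.
apply: cinf_double_inj; have := nabla_metric Hlc X xi xi.
by rewrite (gC xi) !metric_xi eta_xi vfield1 addr0 => <-.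
Qed.

Lemma eta_lie X Y : eta X = 0 -> eta Y = 0 ->
  eta (lie X Y) = - (g X (phi Y) + g X (phi Y)).
Proof.
by move=> X0 Y0; rewrite -cartan_eta X0 Y0 !vfield0 subrr sub0r opprK.
Qed.

Lemma nabla_xiE X : nabla X xi = A X - phi X.
Proof. by rewrite unlock addrK. Qed.

(** By the contact condition the skew part of nabla xi is - phi, which is
exactly what the definition of A removes. *)
Lemma shape_sym X Y : g (A X) Y = g X (A Y).
Proof.
have := cartan_eta X Y; rewrite -!metric_xi (torsion_free Hlc) !gE.
rewrite !(nabla_metric Hlc) !nabla_xiE !gE (gC Y (phi X)) phi_skew (gC Y).
move=> /eqP; rewrite -subr_eq0 => /eqP E; apply/eqP.
by rewrite -subr_eq0 -E; apply/eqP; ring.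
Qed.

Lemma eta_shape X : eta (A X) = 0.
Proof. by rewrite unlock linearD eta_nabla_xi eta_phi addr0. Qed.

Lemma shape_xi : A xi = 0.
Proof.
apply: (metric_inj Hg) => W.
by rewrite shape_sym gC metric_xi eta_shape (metric0l Hg).
Qed.

Fact shape_linear : linear A.
Proof.
move=> f X Y; rewrite unlock (nablaDl Hlc) (nablaZl Hlc) linearD linearZ.
by rewrite scalerDr addrACA.
Qed.
#[local] HB.instance Definition _ :=
  GRing.isLinear.Build (cinf M) (vfield M) (vfield M) *:%R A shape_linear.

Local Notation B X Y Z := (g (nabla_endo A X Y) Z).
Local Notation F X Y Z := (g (nabla_endo phi X Y) Z).

Lemma nabla_shapeC X Y Z : B X Y Z = B X Z Y.
Proof. exact: (nabla_endo_sym Hg Hlc shape_sym). Qed.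

Lemma nabla_phiC X Y Z : F X Y Z = - F X Z Y.
Proof. exact: (nabla_endo_skew Hg Hlc phi_skew). Qed.

(** Without torsion, R(X, Y) xi is the skew part of nabla (nabla xi), and nabla
xi = A - phi. *)
Lemma codazzi X Y Z :
  rm X Y xi Z = B X Y Z - B Y X Z - (F X Y Z - F Y X Z).
Proof.
rewrite /rm !nabla_endoE curvatureE !nabla_xiE (torsion_free Hlc).
by rewrite !(linearB, nablaBr Hlc) !gE; ring.
Qed.

(** The 2-form d eta is closed. In place of d d = 0 the proof uses that - F is
the skew part of nabla (nabla xi), so that the cyclic sum is a Bianchi sum of
components of R(., .) xi. *)
Lemma nabla_phi_cyclic X Y Z : F X Y Z + F Y Z X + F Z X Y = 0.
Proof.
have := rm_bianchi Hg Hlc X Y Z xi; rewrite !(rm_skewr Hg Hlc _ _ _ xi).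
rewrite !codazzi (nabla_shapeC Y X) (nabla_shapeC Z Y) (nabla_shapeC X Z).
rewrite (nabla_phiC Y X) (nabla_phiC Z Y) (nabla_phiC X Z) => E.
by apply: cinf_double_inj; rewrite addr0 -E; ring.
Qed.

Lemma nabla_phi_xi X : nabla_endo phi X xi = phi (phi X) - phi (A X).
Proof.
by rewrite nabla_endoE phi_xi (nabla0r Hlc) sub0r nabla_xiE linearB opprB.
Qed.

Lemma nabla_shape_xi X : nabla_endo A X xi = A (phi X) - A (A X).
Proof.
by rewrite nabla_endoE shape_xi (nabla0r Hlc) sub0r nabla_xiE linearB opprB.
Qed.

Lemma nabla_xi_phi_anticomm X : nabla_endo phi xi X = - (A (phi X) + phi (A X)).
Proof.
apply: (metric_inj Hg) => Y; have := nabla_phi_cyclic xi X Y.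
rewrite (nabla_phiC X Y) !nabla_phi_xi !gE => E.
have e1 : g (phi (phi Y)) X = g (phi (phi X)) Y.
  by rewrite [LHS]phi_skew [RHS]phi_skew gC.
have e2 : g (phi (A Y)) X = - g (A (phi X)) Y.
  by rewrite phi_skew shape_sym gC.
by rewrite -[LHS]subr0 -E e1 e2; ring.
Qed.

(** This is the derivative of phi^2 = I - eta (x) xi. *)
Lemma nabla_phi_phi X Y Z : eta Y = 0 -> eta Z = 0 ->
  F X (phi Y) Z = F X Y (phi Z).
Proof.
move=> Y0 Z0; rewrite !nabla_endoE (phi_phi_horizontal Y0) !gE !phi_skew.
by rewrite (phi_phi_horizontal Z0); ring.
Qed.

(** The derivative of phi^2 = I - eta (x) xi along xi vanishes because nabla_xi
xi = 0; inserting nabla_xi phi = - (A phi + phi A) into it gives A = - phi A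
phi. *)
Lemma shape_phi X : A (phi X) = - phi (A X).
Proof.
have phi2 Y : nabla xi (phi (phi Y)) = phi (phi (nabla xi Y)).
  have xi_xi : nabla xi xi = 0 by rewrite nabla_xiE shape_xi phi_xi subrr.
  rewrite !phi_phi (nablaBr Hlc) (nabla_leibniz Hlc) xi_xi scaler0 addr0.
  by rewrite -!metric_xi (nabla_metric Hlc) xi_xi (metric0r Hg) addr0.
have /eqP := phi2 X; rewrite -subr_eq0.
have -> : nabla xi (phi (phi X)) - phi (phi (nabla xi X)) =
    nabla_endo phi xi (phi X) + phi (nabla_endo phi xi X).
  by rewrite !nabla_endoE linearB addrA subrK.
rewrite !nabla_xi_phi_anticomm.
have -> : A (phi (phi X)) = A X.
  by rewrite phi_phi linearB linearZ /= shape_xi scaler0 subr0.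
rewrite [phi (- _)]linearN [phi (_ + _)]linearD /=.
rewrite (phi_phi_horizontal (eta_shape X)) => /eqP E.
have -> : A X = - phi (A (phi X)).
  apply: (metric_inj Hg) => W; apply: cinf_double_inj.
  have := congr1 (g ^~ W) E; rewrite /= !gE => EW.
  by rewrite -[LHS]addr0 -EW; ring.
by rewrite linearN opprK phi_phi_horizontal// eta_shape.
Qed.

Lemma nabla_xi_phi X : nabla_endo phi xi X = 0.
Proof. by rewrite nabla_xi_phi_anticomm shape_phi addNr oppr0. Qed.

Lemma h_tensorE X : h_tensor phi xi X = phi (A X).
Proof.
apply: (metric_inj Hg) => W; apply: (@cinf_cst_mulI _ _ _ 2).
  by rewrite pnatr_eq0.
rewrite /h_tensor gE mulrA -rmorphM mulfV ?pnatr_eq0// rmorph1 mul1r.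
rewrite /lie_derive_endo !(torsion_free Hlc) !nabla_xiE !linearB.
have := nabla_xi_phi X; rewrite nabla_endoE => /eqP.
rewrite subr_eq0 => /eqP ->.
by rewrite rmorph_nat shape_phi !gE; ring.
Qed.

Lemma phi_h_tensorE X : phi (h_tensor phi xi X) = A X.
Proof. by rewrite h_tensorE phi_phi_horizontal// eta_shape. Qed.

(** * The (kappa, mu) condition *)

Variables kappa mu : R.
Hypothesis Hkm : kappa_mu_condition phi xi eta nabla kappa mu.

Lemma rm_xi X Y Z : rm X Y xi Z =
  kappa%:C * (eta Y * g X Z - eta X * g Y Z)
  + mu%:C * (eta Y * g (phi (A X)) Z - eta X * g (phi (A Y)) Z).
Proof. by rewrite /rm Hkm !h_tensorE !gE; ring. Qed.

(** The Codazzi equation with Y = xi. *)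
Lemma jacobi_xi X W : B xi X W =
  - g (A (A X)) W - (1 + kappa%:C) * g (phi (phi X)) W
  - mu%:C * g (phi (A X)) W.
Proof.
have := codazzi X xi W; rewrite rm_xi eta_xi nabla_shape_xi nabla_phi_xi.
rewrite nabla_xi_phi shape_xi !linear0 shape_phi !gE.
have -> : g X W = g (phi (phi X)) W + eta X * g xi W.
  by rewrite phi_phi !gE subrK.
by move=> /eqP; rewrite -subr_eq0 => /eqP E; rewrite -[LHS]subr0 -E; ring.
Qed.

Lemma nabla_xi_shape_anticomm X :
  nabla_endo A xi (phi X) = - phi (nabla_endo A xi X).
Proof.
have com Z : nabla xi (phi Z) = phi (nabla xi Z).
  have := nabla_xi_phi Z; rewrite nabla_endoE => /eqP.
  by rewrite subr_eq0 => /eqP.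
rewrite !nabla_endoE com !shape_phi (nablaNr Hlc) com [phi (_ - _)]linearB.
by rewrite opprB opprK addrC.
Qed.

(** Compare [jacobi_xi] at X and at phi X: nabla_xi A and phi A anticommute with
phi whereas A^2 and phi^2 commute with it, so the two types of terms separate.
*)
Lemma shape_shape X : A (A X) = (- 1 - kappa)%:C *: phi (phi X).
Proof.
rewrite rmorphB rmorphN rmorph1 -opprD.
have shape_shape_phi Z : A (A (phi Z)) = - (1 + kappa%:C) *: phi (phi (phi Z)).
  apply: (metric_inj Hg) => W; apply: cinf_double_inj; rewrite !gE.
  have skew U : g U (phi W) = - g (phi U) W by rewrite phi_skew opprK.
  have := jacobi_xi (phi Z) W.
  rewrite nabla_xi_shape_anticomm gE phi_skew opprK jacobi_xi !skew.
  rewrite !shape_phi [A (- _)]linearN [phi (- _)]linearN /= shape_phi !gE.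
  by move=> /eqP; rewrite -subr_eq0 => /eqP E; rewrite -[LHS]subr0 -E; ring.
have phi3 Z : phi (phi (phi Z)) = phi Z.
  by rewrite phi_phi_horizontal// eta_phi.
have <- : A (A (phi (phi X))) = A (A X).
  by rewrite phi_phi linearB linearZ /= shape_xi scaler0 subr0.
by rewrite shape_shape_phi phi3.
Qed.

Lemma nabla_xi_shape X : nabla_endo A xi X = - (mu%:C *: phi (A X)).
Proof.
apply: (metric_inj Hg) => W; rewrite jacobi_xi shape_shape !gE.
by rewrite rmorphB rmorphN rmorph1; ring.
Qed.

(** The derivative of A^2, which is a constant multiple of phi^2. *)
Lemma nabla_shape_anticomm X Y Z : eta Y = 0 -> eta Z = 0 ->
  B X (A Y) Z = - B X Y (A Z).
Proof.
move=> Y0 Z0; rewrite !nabla_endoE !gE !shape_sym !shape_shape !gE.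
rewrite (phi_phi_horizontal Y0) (phi_phi_horizontal Z0).
by rewrite (nabla_leibniz Hlc) vfield_cst scale0r add0r !gE; ring.
Qed.

(** * Derivatives of phi and A along ker eta *)

Variables (l : R).
Hypotheses (l_neq0 : l != 0) (l_sqr : l * l = - 1 - kappa).
Local Notation D := (eigen_section A).

Let shape_shapeH X : eta X = 0 -> A (A X) = (l * l)%:C *: X.
Proof. by move=> X0; rewrite shape_shape phi_phi_horizontal// l_sqr. Qed.

Let two_neq0 : 2 != 0 :> R.
Proof. by rewrite pnatr_eq0. Qed.

Lemma eigen_eta a X : a != 0 -> D a X -> eta X = 0.
Proof.
move=> a0 DX; apply: (cinf_cst_mulI a0).
rewrite mulr0; transitivity (eta (a%:C *: X)); first by rewrite linearZ.
by rewrite -DX eta_shape.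
Qed.

Lemma eigen_phi a X : D a X -> D (- a) (phi X).
Proof.
by rewrite /eigen_section shape_phi => ->; rewrite linearZ rmorphN scaleNr.
Qed.

Lemma eigen_orthogonal a X Y : a != 0 -> D a X -> D (- a) Y -> g X Y = 0.
Proof.
move=> a0 DX DY; apply: (@cinf_cst_mulI _ _ _ (2 * a)); first exact: mulf_neq0.
have := shape_sym X Y; rewrite DX DY !gE rmorphN rmorphM rmorph_nat => /eqP.
by rewrite -subr_eq0 mulr0 => /eqP <-; ring.
Qed.

Lemma eigen_split X : eta X = 0 ->
  exists X1 X2, [/\ D l X1, D (- l) X2 & X = X1 + X2].
Proof.
move=> X0.
(* the projections onto the eigendistributions are (l + A) / 2l, (l - A) / 2l *)
pose c := (2 * l)^-1.
have cl : c%:C * l%:C + c%:C * l%:C = 1 :> cinf M.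
  rewrite -rmorphM -rmorphD -mulr2n -mulr_natl mulrCA mulVf ?rmorph1//.
  exact: mulf_neq0.
exists (c%:C *: (l%:C *: X + A X)), (c%:C *: (l%:C *: X - A X)).
split; apply: (metric_inj Hg) => W.
- by rewrite linearZ linearD linearZ /= shape_shapeH// !gE rmorphM; ring.
- rewrite linearZ linearB linearZ /= shape_shapeH// !gE rmorphM rmorphN; ring.
by rewrite !gE -[LHS]mul1r -cl; ring.
Qed.

(** Covariant derivatives are tensorial, so vanishing on horizontal fields can
be tested on eigensections; the roles of l and - l are interchangeable, which
leaves the sign of the first argument free. *)
Lemma nabla_endo_eigen (T : {linear vfield M -> vfield M}) :
    (forall a, a != 0 -> forall X Y Z, D a X -> D a Y \/ D (- a) Y ->
      D a Z \/ D (- a) Z -> g (nabla_endo T X Y) Z = 0) ->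
  forall X Y Z, eta X = 0 -> eta Y = 0 -> eta Z = 0 ->
    g (nabla_endo T X Y) Z = 0.
Proof.
move=> T0 X Y Z /eigen_split[X1 [X2 [DX1 DX2 ->]]].
move=> /eigen_split[Y1 [Y2 [DY1 DY2 ->]]] /eigen_split[Z1 [Z2 [DZ1 DZ2 ->]]].
have {}T0 U V W : D l U \/ D (- l) U -> D l V \/ D (- l) V ->
    D l W \/ D (- l) W -> g (nabla_endo T U V) W = 0.
  case=> DU DV DW; first exact: T0 DU DV DW.
  by apply: T0 DU _ _; rewrite ?oppr_eq0// opprK; apply/or_comm.
rewrite (nabla_endoDl Hlc) !(nabla_endoDr Hlc) !gE.
by rewrite !T0 ?addr0; tauto.
Qed.

Lemma codazzi_horizontal X Y Z : eta X = 0 -> eta Y = 0 ->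
  B X Y Z - B Y X Z = - F Z X Y.
Proof.
move=> X0 Y0; have := codazzi X Y Z; rewrite rm_xi X0 Y0 => E.
have {}E : B X Y Z - B Y X Z = F X Y Z - F Y X Z.
  by apply/eqP; rewrite -subr_eq0 -E; apply/eqP; ring.
rewrite E -[LHS]subr0 -(nabla_phi_cyclic X Y Z) (nabla_phiC Y Z).
by ring.
Qed.

(** Here [nabla_shape_anticomm] reads a B = - a B. *)
Lemma nabla_shape_same a X Y Z : a != 0 -> D a Y -> D a Z -> B X Y Z = 0.
Proof.
move=> a0 DY DZ; apply: (cinf_cst_mulI a0); apply: cinf_double_inj.
have := nabla_shape_anticomm X (eigen_eta a0 DY) (eigen_eta a0 DZ).
rewrite DY DZ (nabla_endoZr Hlc) !gE => E.
by rewrite {1}E addNr mulr0 addr0.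
Qed.

(** In the Codazzi equation for Y, Z and X both values of B vanish. *)
Lemma nabla_phi_same a X Y Z :
  a != 0 -> D a X -> D a Y -> D a Z -> F X Y Z = 0.
Proof.
move=> a0 DX DY DZ.
have := codazzi_horizontal X (eigen_eta a0 DY) (eigen_eta a0 DZ).
rewrite !(nabla_shape_same _ a0)// subrr => /esym/eqP.
by rewrite oppr_eq0 => /eqP.
Qed.

(** Moving phi from one argument to the other carries this case to
[nabla_phi_same]. *)
Lemma nabla_phi_opposite a X Y Z :
  a != 0 -> D a X -> D (- a) Y -> D (- a) Z -> F X Y Z = 0.
Proof.
move=> a0 DX DY DZ; have a0' : - a != 0 by rewrite oppr_eq0.
rewrite -[Y](phi_phi_horizontal (eigen_eta a0' DY)).
rewrite nabla_phi_phi ?eta_phi ?(eigen_eta a0' DZ)//.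
by rewrite (nabla_phi_same a0)// -[a]opprK; apply: eigen_phi.
Qed.

(** For U, V, W in one eigendistribution, F(U, V, phi W) is symmetric in U and V,
by closedness and [nabla_phi_opposite], and skew in V and W, hence zero. *)
Lemma nabla_phi_mixed a X Y Z :
  a != 0 -> D a X -> D a Y -> D (- a) Z -> F X Y Z = 0.
Proof.
move=> a0 DX DY DZ; have a0' : - a != 0 by rewrite oppr_eq0.
have symF U V W : D a U -> D a V -> D a W -> F U V (phi W) = F V U (phi W).
  move=> DU DV DW; have := nabla_phi_cyclic U V (phi W).
  rewrite (nabla_phi_opposite (X := phi W) a0') ?opprK//; last exact: eigen_phi.
  by rewrite (nabla_phiC V) addr0 => /eqP; rewrite subr_eq0 => /eqP.
have skewF U V W : D a U -> D a V -> D a W -> F U V (phi W) = - F U W (phi V).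
  move=> DU DV DW; rewrite -nabla_phi_phi ?(eigen_eta a0 DV, eigen_eta a0 DW)//.
  exact: nabla_phiC.
rewrite -[Z](phi_phi_horizontal (eigen_eta a0' DZ)).
have {DZ} : D a (phi Z) by rewrite -[a]opprK; apply: eigen_phi.
move: (phi Z) => W DW; apply: cinf_double_inj; rewrite addr0 [X in X + _]symF//.
rewrite skewF// [in X in - X]symF// skewF// opprK symF// skewF// symF//.
by rewrite addNr.
Qed.

Lemma nabla_phi_horizontal X Y Z :
  eta X = 0 -> eta Y = 0 -> eta Z = 0 -> F X Y Z = 0.
Proof.
apply: nabla_endo_eigen => a a0 {}X {}Y {}Z DX [] DY [] DZ.
- exact: nabla_phi_same DX DY DZ.
- exact: nabla_phi_mixed DX DY DZ.
- by rewrite nabla_phiC (nabla_phi_mixed a0)// oppr0.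
- exact: nabla_phi_opposite DX DY DZ.
Qed.

(** With F = 0 the Codazzi equation makes B totally symmetric, and two of any
three eigensections belong to the same eigendistribution. *)
Lemma nabla_shape_horizontal X Y Z :
  eta X = 0 -> eta Y = 0 -> eta Z = 0 -> B X Y Z = 0.
Proof.
have symB U V W : eta U = 0 -> eta V = 0 -> eta W = 0 -> B U V W = B V U W.
  move=> U0 V0 W0; apply/eqP; rewrite -subr_eq0 codazzi_horizontal//.
  by rewrite nabla_phi_horizontal// oppr0.
apply: nabla_endo_eigen => a a0 {}X {}Y {}Z DX DY DZ.
have a0' : - a != 0 by rewrite oppr_eq0.
have X0 := eigen_eta a0 DX.
have Y0 : eta Y = 0 by case: DY; exact: eigen_eta.
have Z0 : eta Z = 0 by case: DZ; exact: eigen_eta.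
case: DY DZ => DY [] DZ.
- exact: nabla_shape_same DY DZ.
- by rewrite nabla_shapeC symB// (nabla_shape_same _ a0).
- by rewrite symB// (nabla_shape_same _ a0).
- exact: nabla_shape_same DY DZ.
Qed.

Let nabla_xi_eigen a X : D a X -> nabla X xi = a%:C *: X - phi X.
Proof. by move=> DX; rewrite nabla_xiE DX. Qed.

Let xi_unit : g xi xi = 1.
Proof. by rewrite metric_xi eta_xi. Qed.

Lemma ricci_phi X Y Z W : eta X = 0 -> eta Y = 0 -> eta Z = 0 -> eta W = 0 ->
  rm X Y (phi Z) W + rm X Y Z (phi W) =
    g (nabla X xi) W * g (phi (nabla Y xi)) Z
    - g (nabla Y xi) W * g (phi (nabla X xi)) Z
    + g (nabla Y xi) Z * g (phi (nabla X xi)) W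
    - g (nabla X xi) Z * g (phi (nabla Y xi)) W.
Proof.
move=> X0 Y0 Z0 W0.
have parallel U V U' : g U xi = 0 -> g V xi = 0 -> g U' xi = 0 -> F U V U' = 0.
  by rewrite !metric_xi; exact: nabla_phi_horizontal.
have := ricci_parallel_mod Hg Hlc xi_unit parallel (X := X) (Y := Y) (Z := Z)
  (W := W).
rewrite (metric_xi X) (metric_xi Y) (metric_xi Z) (metric_xi W)
  (metric_xi (lie X Y)) phi_skew opprK => -> //.
rewrite !(nabla_phiC _ Z xi) nabla_xi_phi !nabla_endoE.
rewrite phi_xi !(nabla0r Hlc) !gE; ring.
Qed.

(** The term with mu comes from nabla_xi A through the vertical part of [X, Y],
which the contact condition computes. *)
Lemma ricci_shape X Y Z W : eta X = 0 -> eta Y = 0 -> eta Z = 0 -> eta W = 0 ->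
  rm X Y (A Z) W - rm X Y Z (A W) =
    g (nabla Y xi) W * g (A (nabla X xi)) Z
    - g (nabla X xi) W * g (A (nabla Y xi)) Z
    + g (nabla Y xi) Z * g (A (nabla X xi)) W
    - g (nabla X xi) Z * g (A (nabla Y xi)) W
    - 2 * (mu%:C * g X (phi Y) * g (phi (A Z)) W).
Proof.
move=> X0 Y0 Z0 W0.
have parallel U V U' : g U xi = 0 -> g V xi = 0 -> g U' xi = 0 -> B U V U' = 0.
  by rewrite !metric_xi; exact: nabla_shape_horizontal.
have := ricci_parallel_mod Hg Hlc xi_unit parallel (X := X) (Y := Y) (Z := Z)
  (W := W).
rewrite (metric_xi X) (metric_xi Y) (metric_xi Z) (metric_xi W)
  (metric_xi (lie X Y)) /= shape_sym => -> //.
rewrite !(nabla_shapeC _ Z xi) nabla_xi_shape eta_lie// !nabla_endoE.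
rewrite shape_xi !(nabla0r Hlc) !gE; ring.
Qed.

(** * The curvature on eigensections *)

Lemma horizontal_inj U V : eta U = eta V ->
  (forall W, D l W -> g U W = g V W) ->
  (forall W, D (- l) W -> g U W = g V W) -> U = V.
Proof.
move=> UV Up Um; apply: (metric_inj Hg) => W.
have W0 : eta (W - eta W *: xi) = 0.
  by rewrite linearB linearZ /= eta_xi mulr1 subrr.
have [W1 [W2 [DW1 DW2 eW]]] := eigen_split W0.
rewrite -[W](subrK (eta W *: xi)) eW !(metricDr Hg) !(metricZr Hg) !metric_xi.
by rewrite UV Up// Um.
Qed.

Lemma eta_curvature X Y Z : eta X = 0 -> eta Y = 0 ->
  eta (curvature nabla X Y Z) = 0.
Proof.
move=> X0 Y0; rewrite -metric_xi [LHS](rm_skewr Hg Hlc) rm_xi X0 Y0.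
by ring.
Qed.

Let rmZr f X Y Z W : rm X Y Z (f *: W) = f * rm X Y Z W.
Proof. by rewrite /rm !gE. Qed.

Let rmZl f X Y Z W : rm X Y (f *: Z) W = f * rm X Y Z W.
Proof. by rewrite !(rm_skewr Hg Hlc _ _ _ W) rmZr mulrN. Qed.

Let Nl_neq0 : - l != 0. Proof. by rewrite oppr_eq0. Qed.

Let eta_eigen X : D l X -> eta X = 0. Proof. exact: eigen_eta. Qed.
Let eta_eigenN X : D (- l) X -> eta X = 0. Proof. exact: eigen_eta. Qed.

Let orth X Y : D l X -> D (- l) Y -> g X Y = 0.
Proof. exact: eigen_orthogonal. Qed.
Let orthN Y X : D (- l) Y -> D l X -> g Y X = 0.
Proof. by move=> DY DX; rewrite gC orth. Qed.

Let orth_phi X X' : D l X -> D l X' -> g X (phi X') = 0.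
Proof. by move=> DX DX'; rewrite orth//; exact: eigen_phi. Qed.
Let orth_phiN Y Y' : D (- l) Y -> D (- l) Y' -> g Y (phi Y') = 0.
Proof. by move=> DY DY'; rewrite orthN// -[l]opprK; exact: eigen_phi. Qed.

Let phi_nabla_xi a X : a != 0 -> D a X ->
  phi (nabla X xi) = a%:C *: phi X - X.
Proof.
move=> a0 DX; rewrite (nabla_xi_eigen DX) linearB linearZ /=.
by rewrite (phi_phi_horizontal (eigen_eta a0 DX)).
Qed.

Let shape_nabla_xi a X : a != 0 -> D a X ->
  A (nabla X xi) = a%:C *: (a%:C *: X + phi X).
Proof.
move=> a0 DX; rewrite (nabla_xi_eigen DX) linearB linearZ /= shape_phi DX.
rewrite [phi (_ *: _)]linearZ /=; apply: (metric_inj Hg) => W.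
by rewrite !gE; ring.
Qed.

Let twol_neq0 : 2 * l != 0. Proof. exact: mulf_neq0. Qed.

(** In the names below, the letters p and m record which of the eigenvalues l
and - l belongs to each argument. When Z and W have opposite eigenvalues, the
left side of [ricci_shape] is 2 l or - 2 l times the component sought. *)
Lemma rm_ppmp X X' Y W : D l X -> D l X' -> D (- l) Y -> D l W ->
  rm X X' Y W = l%:C * (g X (phi Y) * g X' W - g X' (phi Y) * g X W).
Proof.
move=> DX DX' DY DW; apply: (cinf_cst_mulI twol_neq0).
have := ricci_shape (eta_eigen DX) (eta_eigen DX') (eta_eigenN DY)
  (eta_eigen DW).
rewrite DY DW rmZl rmZr (shape_nabla_xi l_neq0 DX) (shape_nabla_xi l_neq0 DX').
rewrite (nabla_xi_eigen DX) (nabla_xi_eigen DX') linearZ !gE !phi_skew.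
rewrite (orth DX DY) (orth DX' DY) (orth_phi DX DW) (orth_phi DX' DW).
rewrite (orth_phi DX DX') rmorphN rmorphM rmorph_nat => /eqP.
by rewrite -subr_eq0 => /eqP E; rewrite -[LHS]addr0 -E; ring.
Qed.

Lemma rm_pmpm X Y X' W : D l X -> D (- l) Y -> D l X' -> D (- l) W ->
  rm X Y X' W = - (g X' (phi Y) * g (phi X) W) - l%:C * l%:C * (g X X' * g Y W)
    - mu%:C * (g X (phi Y) * g (phi X') W).
Proof.
move=> DX DY DX' DW; apply: (cinf_cst_mulI twol_neq0).
have := ricci_shape (eta_eigen DX) (eta_eigenN DY) (eta_eigen DX')
  (eta_eigenN DW).
rewrite DX' DW rmZl rmZr (shape_nabla_xi l_neq0 DX) (shape_nabla_xi Nl_neq0 DY).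
rewrite (nabla_xi_eigen DX) (nabla_xi_eigen DY) linearZ !gE !phi_skew.
rewrite (orth DX DW) (orthN DY DX') (orth_phiN DY DW) (orth_phi DX DX').
have -> : g Y (phi X') = - g X' (phi Y) by rewrite gC phi_skew.
rewrite rmorphN rmorphM rmorph_nat => /eqP.
by rewrite -subr_eq0 => /eqP E; rewrite -[LHS]subr0 -E; ring.
Qed.

Lemma rm_ppmm X X' Y W : D l X -> D l X' -> D (- l) Y -> D (- l) W ->
  rm X X' Y W = - (1 - mu%:C) *
    (g X' (phi Y) * g (phi X) W - g X (phi Y) * g (phi X') W).
Proof.
move=> DX DX' DY DW; have := rm_bianchi Hg Hlc X X' Y W.
rewrite (rm_skewl Hg Hlc Y X) (rm_pmpm DX' DY DX DW) (rm_pmpm DX DY DX' DW).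
rewrite (gC X' X) => E.
by rewrite -[LHS]subr0 -E; ring.
Qed.

Lemma rm_pmpp X Y X' W : D l X -> D (- l) Y -> D l X' -> D l W ->
  rm X Y X' W = l%:C * (g W (phi Y) * g X X' - g X' (phi Y) * g X W).
Proof.
move=> DX DY DX' DW; rewrite (rm_pair Hg Hlc) (rm_skewr Hg Hlc) rm_ppmp//.
by rewrite (gC W) (gC X' X); ring.
Qed.

Lemma rm_pppm X X' X'' W : D l X -> D l X' -> D l X'' -> D (- l) W ->
  rm X X' X'' W = l%:C * (g X' X'' * g (phi X) W - g X X'' * g (phi X') W).
Proof.
move=> DX DX' DX'' DW; rewrite (rm_skewr Hg Hlc) rm_ppmp// !phi_skew.
by ring.
Qed.

Lemma rm_pppp X X' X'' W : D l X -> D l X' -> D l X'' -> D l W ->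
  rm X X' X'' W =
    (kappa%:C - 1 + mu%:C) * (g X' X'' * g X W - g X X'' * g X' W).
Proof.
move=> DX DX' DX'' DW.
have := ricci_phi (eta_eigen DX) (eta_eigen DX') (eta_eigen DX'')
  (eta_eigenN (eigen_phi DW)).
rewrite (phi_phi_horizontal (eta_eigen DW)).
rewrite (rm_ppmm DX DX' (eigen_phi DX'') (eigen_phi DW)).
rewrite (phi_nabla_xi l_neq0 DX) (phi_nabla_xi l_neq0 DX').
rewrite (nabla_xi_eigen DX) (nabla_xi_eigen DX') !gE !phi_skew.
rewrite (phi_phi_horizontal (eta_eigen DW)).
rewrite (phi_phi_horizontal (eta_eigen DX'')) !orth_phi//.
have -> : kappa%:C = - 1 - l%:C * l%:C :> cinf M.
  by rewrite -rmorphM l_sqr rmorphB rmorphN rmorph1; ring.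
by move=> /eqP; rewrite -subr_eq0 => /eqP E; rewrite -[LHS]subr0 -E; ring.
Qed.

Let etaE : (forall U V, eta (U + V) = eta U + eta V) *
  (forall U, eta (- U) = - eta U) * (forall f U, eta (f *: U) = f * eta U).
Proof. by do !split=> *; rewrite ?linearD ?linearN ?linearZ. Qed.

Lemma curvature_ppp X X' X'' : D l X -> D l X' -> D l X'' ->
  curvature nabla X X' X'' =
    (kappa - 1 + mu)%:C *: (g X' X'' *: X - g X X'' *: X')
    + l%:C *: (g X' X'' *: phi X - g X X'' *: phi X').
Proof.
move=> DX DX' DX''; apply: horizontal_inj => [|W DW|W DW].
- rewrite (eta_curvature _ (eta_eigen DX) (eta_eigen DX')) !etaE !eta_phi.
  by rewrite (eta_eigen DX) (eta_eigen DX'); ring.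
- rewrite [LHS]rm_pppp// !gE !phi_skew !orth_phi// rmorphD rmorphB rmorph1.
  by ring.
- rewrite [LHS]rm_pppm// !gE (orth DX DW) (orth DX' DW); ring.
Qed.

Lemma curvature_ppm X X' Y : D l X -> D l X' -> D (- l) Y ->
  curvature nabla X X' Y =
    - (l%:C *: (g X' (phi Y) *: X - g X (phi Y) *: X'))
    - (1 - mu)%:C *: (g X' (phi Y) *: phi X - g X (phi Y) *: phi X').
Proof.
move=> DX DX' DY; apply: horizontal_inj => [|W DW|W DW].
- rewrite (eta_curvature _ (eta_eigen DX) (eta_eigen DX')) !etaE !eta_phi.
  by rewrite (eta_eigen DX) (eta_eigen DX'); ring.
- rewrite [LHS]rm_ppmp// !gE !phi_skew (orth_phi DX DW) (orth_phi DX' DW); ring.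
- rewrite [LHS]rm_ppmm// !gE (orth DX DW) (orth DX' DW) rmorphB rmorph1; ring.
Qed.

Lemma curvature_pmp X Y X' : D l X -> D (- l) Y -> D l X' ->
  curvature nabla X Y X' =
    - (l%:C *: (g X' (phi Y) *: X)) - g X' (phi Y) *: phi X
    - (l ^+ 2)%:C *: (g X X' *: Y) + l%:C *: (g X X' *: phi Y)
    - mu%:C *: (g X (phi Y) *: phi X').
Proof.
move=> DX DY DX'; apply: horizontal_inj => [|W DW|W DW].
- rewrite (eta_curvature _ (eta_eigen DX) (eta_eigenN DY)) !etaE !eta_phi.
  by rewrite (eta_eigen DX) (eta_eigenN DY); ring.
- rewrite [LHS]rm_pmpp// !gE !(phi_skew X) !(phi_skew X') (orth_phi DX DW).
  by rewrite (orth_phi DX' DW) (gC W) (orthN DY DW); ring.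
- rewrite [LHS]rm_pmpm// !gE (orth DX DW) (phi_skew Y) (orth_phiN DY DW).
  by rewrite expr2 rmorphM; ring.
Qed.

End ParacontactMetric.

Theorem theorem5p8 (R : realType) (n : nat) (M : manifold R n.*2.+1)
    (phi : {linear vfield M -> vfield M}) (xi : vfield M)
    (eta : {scalar vfield M}) (g : vfield M -> vfield M -> cinf M)
    (nabla : vfield M -> vfield M -> vfield M) (kappa mu : R)
    (Hpcm : paracontact_metric phi xi eta g)
    (Hlc : levi_civita g nabla)
    (Hkm : kappa_mu_condition phi xi eta nabla kappa mu)
    (Hkappa : kappa < -1) :
  let lambda : R := Num.sqrt (- 1 - kappa) in
  let phih : vfield M -> vfield M := fun X => phi (h_tensor phi xi X) in
  let Rm := curvature nabla in
  (exists k, forall p : M, index_at g (eigen_at phih lambda p) k) ->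
  (exists k, forall p : M, index_at g (eigen_at phih (- lambda) p) k) ->
  forall X X' X'' Y Y' Y'' : vfield M,
  eigen_section phih lambda X ->
  eigen_section phih lambda X' ->
  eigen_section phih lambda X'' ->
  eigen_section phih (- lambda) Y ->
  eigen_section phih (- lambda) Y' ->
  eigen_section phih (- lambda) Y'' ->
  Rm X X' X'' =
    (kappa - 1 + mu)%:C *: (g X' X'' *: X - g X X'' *: X')
    + lambda%:C *: (g X' X'' *: phi X - g X X'' *: phi X')
  /\
  Rm X X' Y =
    - (lambda%:C *: (g X' (phi Y) *: X - g X (phi Y) *: X'))
    - (1 - mu)%:C *: (g X' (phi Y) *: phi X - g X (phi Y) *: phi X')
  /\
  Rm X Y X' =
    - (lambda%:C *: (g X' (phi Y) *: X))
    - g X' (phi Y) *: phi X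
    - (lambda ^+ 2)%:C *: (g X X' *: Y)
    + lambda%:C *: (g X X' *: phi Y)
    - mu%:C *: (g X (phi Y) *: phi X')
  /\
  Rm X Y Y' =
    (lambda ^+ 2)%:C *: (g Y Y' *: X)
    + lambda%:C *: (g Y Y' *: phi X)
    + lambda%:C *: (g X (phi Y') *: Y)
    - g X (phi Y') *: phi Y
    - mu%:C *: (g X (phi Y) *: phi Y')
  /\
  Rm Y Y' X =
    - (lambda%:C *: (g X (phi Y') *: Y - g X (phi Y) *: Y'))
    + (1 - mu)%:C *: (g X (phi Y') *: phi Y - g X (phi Y) *: phi Y')
  /\
  Rm Y Y' Y'' =
    (kappa - 1 + mu)%:C *: (g Y' Y'' *: Y - g Y Y'' *: Y')
    - lambda%:C *: (g Y' Y'' *: phi Y - g Y Y'' *: phi Y').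
Proof.
move=> lambda phih Rm _ _ X X' X'' Y Y' Y''.
have lambda_sqr : lambda * lambda = - 1 - kappa.
  by rewrite -expr2 sqr_sqrtr// subr_ge0 ltW.
have lambda_neq0 : lambda != 0 by rewrite gt_eqF// sqrtr_gt0 subr_gt0.
have Nlambda_sqr : (- lambda) * (- lambda) = - 1 - kappa by rewrite mulrNN.
have Nlambda_neq0 : - lambda != 0 by rewrite oppr_eq0.
have -> : phih = shape_operator nabla phi xi.
  by apply/funext => Z; exact: phi_h_tensorE Hpcm Hlc Z.
move=> DX DX' DX'' DY DY' DY''; have Hg := pcm_metric Hpcm.
have skew Z W : g Z (phi W) = - g W (phi Z).
  by rewrite (Defs.metric_sym Hg) (phi_skew Hpcm).
have {}DX : eigen_section (shape_operator nabla phi xi) (- - lambda) X /\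
    eigen_section (shape_operator nabla phi xi) lambda X by rewrite opprK.
have ppp := curvature_ppp Hpcm Hlc Hkm.
have ppm := curvature_ppm Hpcm Hlc Hkm.
have pmp := curvature_pmp Hpcm Hlc Hkm.
split; first by apply: ppp => //; case: DX.
split; first by apply: ppm => //; case: DX.
split; first by apply: pmp => //; case: DX.
split.
  rewrite /Rm (curvature_skew Hg Hlc) (pmp (- lambda) _ _ Y X Y')//; last first.
    by case: DX.
  rewrite !(skew _ X) sqrrN; apply: (metric_inj Hg) => W.
  by rewrite !(metricE Hg) rmorphN; ring.
split.
  rewrite /Rm (ppm (- lambda) _ _ Y Y' X)//; last by case: DX.
  rewrite !(skew _ X); apply: (metric_inj Hg) => W.
  by rewrite !(metricE Hg) rmorphN; ring.
by rewrite /Rm (ppp (- lambda))// rmorphN scaleNr.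
Qed.
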